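(* Let $B$ be an associative commutative (not necessarily unital) algebra over a field with a derivation $d$, and let $A=\mathrm{GD}(B,d)$ be the Novikov algebra on the vector space $B$ with multiplication $x\circ y=x\,d(y)$. Then: (i) if $B$ is nil, then $A$ is r-nil; (ii) if $B$ is nilpotent, then $A$ is nilpotent; (iii) if $B$ is quasiregular, then $A$ is left quasiregular.
   Context: A Novikov algebra is a (not necessarily associative or unital) algebra satisfying the identities $(x,y,z)=(y,x,z)$ and $(xy)z=(xz)y$, where $(x,y,z)=(xy)z-x(yz)$. Derivations are linear over the ground field. $\mathrm{GD}(B,d)$ is called the Gelfand–Dorfman construction. Left-normed powers of an element of a Novikov algebra: $x^1=x$, $x^n=x^{n-1}x$ for $n>1$. A Novikov algebra is r-nil if for every element $x$ there is $n>0$ with $x^n=0$. An algebra is nilpotent if there is $n$ such that every product of $n$ elements, with any arrangement of brackets, is zero. An algebra $A$ with product $\cdot$ is left quasiregular if for every $x\in A$ there is $y\in A$ with $x+y=y\cdot x$. An associative commutative algebra $B$ is nil if all its elements are nilpotent, and quasiregular if for every $x\in B$ there is $z\in B$ with $x+z=xz$. *)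

(* Defs.v *)
From HB Require Import structures.
From mathcomp Require Import all_boot all_order all_algebra.

Set Implicit Arguments.
Unset Strict Implicit.
Unset Printing Implicit Defensive.

Import GRing.Theory.
Local Open Scope ring_scope.

(* Products of algebras are the magma products [(x * y)%g]: the ring products *)
(* of [ssralg] come with a unit, which is not wanted here.                    *)

HB.mixin Record isBilinearMul (F : fieldType) A of GRing.Lmodule F A & Magma A := {
  amul_linearl : forall (a : F) (x y z : A),
    ((a *: x + y)%R * z)%g = a *: (x * z)%g + (y * z)%g;
  amul_linearr : forall (a : F) (z x y : A),
    (z * (a *: x + y)%R)%g = a *: (z * x)%g + (z * y)%g
}.

#[short(type="naAlgType")]
HB.structure Definition NAAlgebra (F : fieldType) :=
  {A of isBilinearMul F A & GRing.Lmodule F A & ChoiceMagma A}.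

HB.mixin Record isCommutativeAlgebra (F : fieldType) A of NAAlgebra F A := {
  amulC : commutative (fun x y : A => (x * y)%g)
}.

#[short(type="comNuAlgType")]
HB.structure Definition ComNuAlgebra (F : fieldType) :=
  {A of isCommutativeAlgebra F A & NAAlgebra F A & Semigroup A}.

Definition associator (F : fieldType) (A : naAlgType F) (x y z : A) : A :=
  ((x * y) * z)%g - (x * (y * z))%g.

HB.mixin Record isNovikov (F : fieldType) A of NAAlgebra F A := {
  associatorC12 : forall x y z : A, associator x y z = associator y x z;
  novikov_mulAC : forall x y z : A, ((x * y) * z)%g = ((x * z) * y)%g
}.

#[short(type="novikovAlgType")]
HB.structure Definition Novikov (F : fieldType) :=
  {A of isNovikov F A & NAAlgebra F A}.

HB.mixin Record isDerivation (F : fieldType) (B : naAlgType F) (d : B -> B) := {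
  derivationM : forall x y : B, d (x * y)%g = (d x * y)%g + (x * d y)%g
}.

#[short(type="derivation")]
HB.structure Definition Derivation (F : fieldType) (B : naAlgType F) :=
  {d of isDerivation F B d & @GRing.Linear F B B *:%R d}.

Definition GD (F : fieldType) (B : comNuAlgType F) (d : derivation B) : Type := B.

Section GelfandDorfman.
Variables (F : fieldType) (B : comNuAlgType F) (d : derivation B).

HB.instance Definition _ := GRing.Lmodule.copy (GD d) B.

Definition GD_mul (x y : GD d) : GD d := ((x : B) * d y)%g.

Fact GD_mul_linearl (a : F) (x y z : GD d) :
  GD_mul (a *: x + y) z = a *: GD_mul x z + GD_mul y z.
Proof. exact: (@amul_linearl F B a x y (d z)). Qed.

Fact GD_mul_linearr (a : F) (z x y : GD d) :
  GD_mul z (a *: x + y) = a *: GD_mul z x + GD_mul z y.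
Proof.
have dE : d (a *: (x : B) + y) = a *: d x + d y by rewrite linearP.
rewrite /GD_mul [X in (_ * X)%g]dE.
exact: (@amul_linearr F B a z (d x) (d y)).
Qed.

HB.instance Definition _ := hasMul.Build (GD d) GD_mul.
HB.instance Definition _ :=
  isBilinearMul.Build F (GD d) GD_mul_linearl GD_mul_linearr.

Lemma GD_mulE (x y : GD d) : (x * y)%g = ((x : B) * d y)%g :> B.
Proof. by []. Qed.

Fact GD_associatorE (x y z : GD d) :
  associator x y z = - ((x : B) * (y : B) * d (d z))%g.
Proof.
change (((x : B) * d y * d z)%g - ((x : B) * d ((y : B) * d z)%g)%g
  = - ((x : B) * (y : B) * d (d z))%g).
have mulDr (u v w : B) : (u * (v + w)%R)%g = (u * v)%g + (u * w)%g.
  by rewrite -[v]scale1r amul_linearr !scale1r.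
by rewrite derivationM mulDr !mulgA opprD addrA subrr add0r.
Qed.

Fact GD_associatorC (x y z : GD d) : associator x y z = associator y x z.
Proof. by rewrite !GD_associatorE (amulC (x : B)). Qed.

Fact GD_mulAC (x y z : GD d) : ((x * y) * z)%g = ((x * z) * y)%g.
Proof.
change (((x : B) * d y) * d z = ((x : B) * d z) * d y)%g.
by rewrite -!mulgA (amulC (d y)).
Qed.

HB.instance Definition _ := isNovikov.Build F (GD d) GD_associatorC GD_mulAC.

End GelfandDorfman.

(* [lnpow x n] is the left-normed power [x^n] for [n > 0]; the value at [n = 0] *)
(* is meaningless, since there is no unit.                                    *)
Definition lnpow (A : magmaType) (x : A) (n : nat) : A :=
  iter n.-1 (fun y => (y * x)%g) x.

(* [product_of n x]: [x] is a product of [n] elements of [A] with some        *)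
(* arrangement of brackets; it holds for no [x] when [n = 0].                 *)
Inductive product_of (A : magmaType) : nat -> A -> Prop :=
| product_of1 x : product_of 1 x
| product_ofM m n x y :
    product_of m x -> product_of n y -> product_of (m + n) (x * y)%g.

Section Properties.
Variable F : fieldType.

Definition r_nil (A : novikovAlgType F) : Prop :=
  forall x : A, exists2 n : nat, (0 < n)%N & lnpow x n = 0.

Definition nilpotent_alg (A : naAlgType F) : Prop :=
  exists2 n : nat, (0 < n)%N & forall x : A, product_of n x -> x = 0.

Definition left_quasiregular (A : naAlgType F) : Prop :=
  forall x : A, exists y : A, x + y = (y * x)%g.

Definition nil_alg (B : comNuAlgType F) : Prop :=
  forall x : B, exists2 n : nat, (0 < n)%N & lnpow x n = 0.

Definition quasiregular (B : comNuAlgType F) : Prop :=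
  forall x : B, exists z : B, x + z = (x * z)%g.

End Properties.

(* Main.v *)
Require Import Defs.
From mathcomp Require Import all_boot all_order all_algebra.

(** Multiplying by [x] on the right in [GD d] is multiplying by [d x] in [B], so
    the left-normed power [x^(n+1)] of [GD d] is [x (d x)^n], and (i) follows
    from the nilpotency of [d x]. By the Leibniz rule [d] maps each power [B^n]
    to itself, so every product of [n] elements of [GD d] lies in [B^n]: this is
    (ii). For (iii), if [z] is a quasi-inverse of [d x], formally
    [(1 - d x)(1 - z) = 1], then [y = - x (1 - z) = x z - x] solves
    [x + y = y (d x)]. *)

Import GRing.Theory.
Local Open Scope ring_scope.

Lemma lnpowS (A : magmaType) (x : A) n :
  (0 < n)%N -> lnpow x n.+1 = (lnpow x n * x)%g.
Proof. by case: n. Qed.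

Section NonassociativeAlgebra.
Variables (F : fieldType) (A : naAlgType F).
Implicit Types x y z : A.

Lemma amulDl x y z : ((x + y)%R * z)%g = (x * z)%g + (y * z)%g.
Proof. by rewrite -[x]scale1r amul_linearl !scale1r. Qed.

Lemma amulDr x y z : (x * (y + z)%R)%g = (x * y)%g + (x * z)%g.
Proof. by rewrite -[y]scale1r amul_linearr !scale1r. Qed.

Lemma amul0l x : ((0 : A) * x)%g = 0.
Proof. by apply: (@addrI _ (0 * x)%g); rewrite -amulDl !addr0. Qed.

Lemma amul0r x : (x * (0 : A))%g = 0.
Proof. by apply: (@addrI _ (x * 0)%g); rewrite -amulDr !addr0. Qed.

Lemma amulBl x y z : ((x - y)%R * z)%g = (x * z)%g - (y * z)%g.
Proof. by apply: (@addIr _ (y * z)%g); rewrite -amulDl !subrK. Qed.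

(** The power $A^n$. Sums are allowed because the Leibniz rule turns one product into a sum of
    products; scalars can be absorbed into a factor. *)
Inductive alg_power (n : nat) : A -> Prop :=
| alg_power0 : alg_power n 0
| alg_powerD x y : product_of n x -> alg_power n y -> alg_power n (x + y).

Lemma product_of_alg_power n x : product_of n x -> alg_power n x.
Proof. by move=> xP; rewrite -[x]addr0; apply/alg_powerD/alg_power0. Qed.

Lemma alg_power_add n x y :
  alg_power n x -> alg_power n y -> alg_power n (x + y).
Proof.
by move=> + yP; elim=> [|u v uP _ IHv]; rewrite ?add0r // -addrA; apply: alg_powerD.
Qed.

Lemma alg_powerM m n x y :
  alg_power m x -> alg_power n y -> alg_power (m + n) (x * y)%g.
Proof.
move=> xP yP; elim: xP => [|u v uP _ IHv]; first by rewrite amul0l; apply: alg_power0.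
rewrite amulDl; apply: alg_power_add IHv.
elim: yP => [|s t sP _ IHt]; first by rewrite amul0r; apply: alg_power0.
by rewrite amulDr; apply: alg_powerD => //; apply: product_ofM.
Qed.

Lemma alg_power_eq0 n x :
  (forall y, product_of n y -> y = 0) -> alg_power n x -> x = 0.
Proof. by move=> n0; elim=> // u v /n0 -> _ ->; rewrite addr0. Qed.

Lemma alg_power_derivation (d : derivation A) n x :
  alg_power n x -> alg_power n (d x).
Proof.
elim=> [|u v uP _ IHv]; first by rewrite linear0; apply: alg_power0.
have -> : d (u + v) = d u + d v by exact: linearD.
apply: alg_power_add IHv.
(* Induction on the bracketing: $A^1$ is all of $A$, and each Leibniz term of [s * t] differentiates
   one factor, which stays in its power, and keeps the other. *)
elim: uP => [w|k l s t sP IHs tP IHt].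
  by apply/product_of_alg_power/product_of1.
rewrite derivationM; apply: alg_power_add; apply: alg_powerM => //.
  exact: product_of_alg_power.
exact: product_of_alg_power.
Qed.

End NonassociativeAlgebra.

Section GelfandDorfmanPowers.
Variables (F : fieldType) (B : comNuAlgType F) (d : derivation B).

(** Each further factor [x] in [GD d] appends [d x], and associativity of [B] collects these. At
    [n = 0] the formula fails: [lnpow (d x) 0] is [d x], not a unit. *)
Lemma GD_lnpow (x : B) n :
  (0 < n)%N -> lnpow (x : GD d) n.+1 = (x * lnpow (d x) n)%g :> B.
Proof.
case: n => // n _; elim: n => // n IHn.
by rewrite lnpowS // GD_mulE IHn [in RHS]lnpowS // mulgA.
Qed.

Lemma GD_product_of (x : GD d) n : product_of n x -> alg_power F B n x.
Proof.
elim=> [y|k l s t _ IHs _ IHt]; first by apply/product_of_alg_power/product_of1.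
by rewrite GD_mulE; apply/alg_powerM/alg_power_derivation.
Qed.

End GelfandDorfmanPowers.

Theorem proposition4p1 (F : fieldType) (B : comNuAlgType F) (d : derivation B) :
  [/\ nil_alg B -> r_nil (GD d),
      nilpotent_alg B -> nilpotent_alg (GD d)
    & quasiregular B -> left_quasiregular (GD d)].
Proof.
split.
- move=> nilB x; have [n n_gt0 dxn0] := nilB (d x).
  by exists n.+1 => //; rewrite GD_lnpow // dxn0; apply: (amul0r F B).
- case=> n n_gt0 Bn0; exists n => // x /GD_product_of.
  exact: alg_power_eq0.
- move=> qrB x; have [z dxz] := qrB (d x).
  exists ((((x : B) * z)%g - x)%R : B); rewrite GD_mulE.
  (* Both sides equal [x * z]: on the right, $xz\,d(x) = x(d(x) + z)$ by the choice of [z], and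
     $x\,d(x)$ cancels. *)
  rewrite amulBl -mulgA (amulC z) -dxz amulDr.
  by rewrite [RHS]addrAC subrr add0r addrC subrK.
Qed.
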